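(* Let $\lambda_1,\mu_1,\lambda_2,\mu_2$ be real numbers and $\varepsilon>0$. Set $A=\max\left(17,\left\lceil 2\pi\frac{|\lambda_1|+|\lambda_2|+|\mu_1|+|\mu_2|}{\varepsilon}\right\rceil^2\right)$. Let $\theta_1,\theta_2$ be real numbers and set $s=\min(\lambda_1^2+\mu_1^2+2\lambda_1\mu_1\cos\theta_1,\ \lambda_2^2+\mu_2^2+2\lambda_2\mu_2\cos\theta_2)$. Then for all integers $n\ge A$ and all integers $1\le k,\ell\le n-1$ with $k\ne\ell$, $k\ne n-\ell$ and $\gcd(k,\ell,n)=1$, there is $t\in\mathbb{Z}$ such that \[\lambda_1\cos\frac{k(\theta_1+2\pi t)}{n}+\mu_1\cos\frac{(n-k)(\theta_1+2\pi t)}{n}+\lambda_2\cos\frac{\ell(\theta_2+2\pi t)}{n}+\mu_2\cos\frac{(n-\ell)(\theta_2+2\pi t)}{n}>\sqrt{s}-\varepsilon.\] *)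

(* Defs.v *)
From mathcomp Require Import all_boot all_order all_algebra.
From mathcomp Require Import all_classical all_reals all_analysis.

Set Implicit Arguments.
Unset Strict Implicit.
Unset Printing Implicit Defensive.

(* Main.v *)
(* Since cos((n-k)x/n) = cos(theta - kx/n) when x is theta modulo 2 pi, each
   pair of terms is a single cosine r_i * cos(. - phi_i), where r_i is the
   square root of the i-th entry of the minimum s. So one looks for t making
   r1 cos(alpha + 2 pi k t/n) + r2 cos(beta + 2 pi l t/n) > min(r1, r2) - eps.
   By pigeonhole the subgroup of (R/Z)^2 generated by (k/n, l/n), of order n,
   contains a nonzero element represented by (a/n, b/n) with |a| and |b| less
   than n/m, where m < sqrt n <= m + 1. Its multiples approximate every point
   of the real line in the direction (a, b) through any point of the subgroup
   up to pi/m in each coordinate, which costs (r1 + r2) pi/m < eps. If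
   |b| <= |a|, then, as n divides none of l, l - k and l + k, one such line
   contains a point with first cosine 1 and second cosine nonnegative, so the
   sum there is at least r1; otherwise swap the roles. *)
Require Import Defs.
From mathcomp Require Import all_boot all_order all_algebra.
From mathcomp Require Import all_classical all_reals all_analysis.
From mathcomp Require Import ring lra zify.
Set Implicit Arguments.
Unset Strict Implicit.
Unset Printing Implicit Defensive.
Import Order.TTheory GRing.Theory Num.Theory.
Import numFieldNormedType.Exports.
Local Open Scope ring_scope.

(** * Cosines along arithmetic progressions and the amplitude-phase form *)

Lemma cosD2piz (R : realType) (x : R) (z : int) :
  cos (x + 2 * pi * z%:~R) = cos x.
Proof.
have per (m : nat) y : cos (y + 2 * pi * m%:R) = cos y :> R.
  by rewrite mulr_natl mulr_natr; exact: periodicn (@cosD2pi R) m y.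
case: (intP z) => [|m|m]; first by rewrite mulr0 addr0.
  exact: per.
by rewrite -(per m.+1 (x + _)) mulrNz mulrN subrK.
Qed.

(** Each [2 * sin h * cos y] equals [sin (y + h) - sin (y - h)]; as the step is [h + h], consecutive
    terms cancel. *)
Lemma sumr_cos_telescope (R : realType) (x h : R) (N : nat) :
  2 * sin h * \sum_(j < N) cos (x + (h + h) * j%:R) =
  sin (x - h + (h + h) * N%:R) - sin (x - h).
Proof.
elim: N => [|N IHN]; first by rewrite big_ord0 !mulr0 addr0 subrr.
rewrite big_ord_recr /= mulrDr IHN -(natr1 N).
set y := x + (h + h) * N%:R.
have -> : x - h + (h + h) * N%:R = y - h by rewrite /y; ring.
have -> : x - h + (h + h) * (N%:R + 1) = y + h by rewrite /y; ring.
rewrite !sinD sinN cosN; ring.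
Qed.

(* The cosines along a nontrivial arithmetic progression of angles modulo
   [2 * pi] sum to zero, so they are not all negative. *)
Lemma cos_progression_ge0 (R : realType) (x : R) (N c : int) :
  N != 0 -> ~~ (N %| c)%Z ->
  exists t : int, 0 <= cos (x + 2 * pi * (c%:~R * t%:~R / N%:~R)).
Proof.
wlog : N c / 0 <= N => [wlogN|].
  case: (leP 0 N) => [|N_lt0]; first exact: wlogN.
  move=> N_neq0 NNc; have [|||t] := wlogN (- N) (- c).
  - by rewrite oppr_ge0 ltW.
  - by rewrite oppr_eq0.
  - by rewrite dvdzE !abszN -dvdzE.
  by rewrite !rmorphN /= invrN mulNr mulrNN; exists t.
case: N => // N _ N_neq0'; have N_gt0 : (0 < N)%N by rewrite lt0n.
move=> NNc; rewrite -[N%:~R]/(N%:R).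
have N_neq0 : N%:R != 0 :> R by rewrite pnatr_eq0 -lt0n.
(* Reducing [c] modulo [N] puts the half step [h] strictly between 0 and [pi], so [sin h] can be
   cancelled; [N] steps make [r] whole turns. *)
set r := (c %% N%:Z)%Z.
have r_gt0 : 0 < r by rewrite lt_neqAle eq_sym modz_ge0 ?andbT; lia.
have r_ltN : r < N by rewrite /r ltz_pmod; lia.
pose h : R := pi * (r%:~R / N%:R).
have sinh_gt0 : 0 < sin h.
  apply: sin_gt0_pi.
  rewrite /h pmulr_rgt0 ?pi_gt0 // divr_gt0 ?ltr0z ?ltr0n //=.
  rewrite -[ltRHS]mulr1 ltr_pM2l ?pi_gt0 // ltr_pdivrMr ?ltr0n // mul1r.
  by rewrite -[N%:R]/(N%:Z%:~R) ltr_int.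
have sum0 : \sum_(j < N) cos (x + (h + h) * j%:R) = 0.
  apply: (mulfI (_ : 2 * sin h != 0)); first by rewrite lt0r_neq0 // mulr_gt0.
  rewrite mulr0 sumr_cos_telescope.
  have -> : (h + h) * N%:R = 2 * pi * r%:~R by rewrite /h; field.
  have shift (y z : R) : sin (y + 2 * pi * r%:~R) = sin y.
    by rewrite -[LHS]cosBpihalf addrAC cosD2piz cosBpihalf.
  by rewrite shift ?subrr.
have [/existsP[j cosj_ge0]|/existsPn neg] :=
    boolP [exists j : 'I_N, 0 <= cos (x + (h + h) * j%:R)].
  exists (j : nat)%:Z; suff -> : cos (x + 2 * pi * (c%:~R * j%:~R / N%:R)) =
    cos (x + (h + h) * j%:R) by [].
  rewrite -[RHS](cosD2piz _ ((c %/ N%:Z)%Z * (j : nat)%:Z)); congr cos.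
  have -> : c%:~R = (c %/ N%:Z)%Z%:~R * N%:R + r%:~R :> R.
    by rewrite {1}(divz_eq c N) rmorphD rmorphM.
  by rewrite rmorphM /= /h; field.
suff : \sum_(j < N) cos (x + (h + h) * j%:R) < 0 by rewrite sum0 ltxx.
rewrite -oppr_gt0 -sumrN (bigD1 (Ordinal N_gt0)) //=.
apply: ltr_pwDl; first by rewrite oppr_gt0 ltNge (neg (Ordinal N_gt0)).
by apply: sumr_ge0 => j _; rewrite oppr_ge0 ltW // ltNge neg.
Qed.

Lemma cos_lipschitz (R : realType) (x y : R) : `|cos x - cos y| <= `|x - y|.
Proof.
wlog le_yx : x y / y <= x.
  by case/orP: (le_total x y) => ? th; [rewrite distrC (distrC x)|]; exact: th.
have [|z _ ->] := @MVT_segment R cos (fun z => - sin z) y x le_yx.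
  by apply: continuous_subspaceT; exact: continuous_cos.
by rewrite normrM normrN ler_piMl // sin_max.
Qed.

(* [sqrt (lambda^2 + mu^2 + 2 lambda mu cos theta)] is the modulus of
   [lambda + mu * exp (i theta)]. *)
Lemma cos_combination_amplitude (R : realType) (lambda mu theta : R) :
  exists2 r : R,
    r = Num.sqrt (lambda ^+ 2 + mu ^+ 2 + 2 * lambda * mu * cos theta) &
    r <= `|lambda| + `|mu| /\
    exists phi : R, forall x : R,
      lambda * cos x + mu * cos (theta - x) = r * cos (x - phi).
Proof.
set S := _ + _ + _; exists (Num.sqrt S) => //; split.
  rewrite -[leRHS]ger0_norm ?addr_ge0 // -sqrtr_sqr ler_wsqrtr //.
  have : lambda * mu * cos theta <= `|lambda| * `|mu|.
    by rewrite (le_trans (ler_norm _)) // !normrM ler_piMr ?mulr_ge0 // cos_max.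
  rewrite sqrrD !real_normK ?num_real // /S; lra.
set P := lambda + mu * cos theta; set Q := mu * sin theta.
have SE : S = P ^+ 2 + Q ^+ 2.
  rewrite /S /P /Q [in RHS]exprMn sin2cos2; ring.
have S_ge0 : 0 <= S by rewrite SE addr_ge0 ?sqr_ge0.
have PQ x : lambda * cos x + mu * cos (theta - x) = P * cos x + Q * sin x.
  rewrite cosB /P /Q; ring.
suff [phi PE QE] : exists2 phi, P = Num.sqrt S * cos phi &
                                Q = Num.sqrt S * sin phi.
  by exists phi => x; rewrite PQ cosB PE QE; ring.
have [S0|S_neq0] := eqVneq S 0.
  exists 0; rewrite S0 sqrtr0 mul0r; apply/eqP; move/eqP: SE;
  by rewrite S0 eq_sym paddr_eq0 ?sqr_ge0 // !sqrf_eq0 => /andP[].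
have r_gt0 : 0 < Num.sqrt S by rewrite sqrtr_gt0 lt0r S_neq0.
have le_Pr : -1 <= P / Num.sqrt S <= 1.
  rewrite -ler_norml normrM normfV (gtr0_norm r_gt0) ler_pdivrMr // mul1r.
  by rewrite -sqrtr_sqr ler_wsqrtr // SE lerDl sqr_ge0.
have Pcos : P = Num.sqrt S * cos (acos (P / Num.sqrt S)).
  by rewrite acosK ?in_itv //= mulrC divfK ?gt_eqF.
have Qsin : `|Q| = Num.sqrt S * sin (acos (P / Num.sqrt S)).
  rewrite sin_acos // -{1}(sqrtrM _) //.
  rewrite exprMn exprVn sqr_sqrtr // mulrBr mulr1 mulrCA divff // mulr1 SE.
  by rewrite [X in X - _]addrC addrK sqrtr_sqr.
(* [acos] only yields angles with nonnegative sine, so the sign of [Q] decides the sign of the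
   phase. *)
have [Q_ge0|Q_lt0] := leP 0 Q.
  by exists (acos (P / Num.sqrt S)) => //; rewrite -Qsin ger0_norm.
exists (- acos (P / Num.sqrt S)); first by rewrite cosN.
by rewrite sinN mulrN -Qsin ltr0_norm ?opprK.
Qed.

(** * Short vectors of the subgroup and approximation along its lines *)

(** Pigeonhole: the [n] multiples of [(k, l)] modulo [n] fall into [m ^ 2 < n] boxes of side
    [n / m], and two in the same box have a short difference. *)
Lemma short_lattice_vector (n k l m : nat) :
  (0 < n)%N -> (m ^ 2 < n)%N -> gcdn (gcdn k l) n = 1%N ->
  exists t a b p q : int,
    [/\ k%:Z * t = a + n%:Z * p, l%:Z * t = b + n%:Z * q,
        (a != 0) || (b != 0), `|a| * m%:Z < n%:Z & `|b| * m%:Z < n%:Z].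
Proof.
move=> n_gt0 m2_ltn kln1.
have [->|m_gt0] := posnP m.
  (* For [m = 0] both size bounds read [0 < n], so the nonzero vector [(n, 0)] will do. *)
  exists n%:Z, n%:Z, 0, (k%:Z - 1), l%:Z.
  by split; rewrite ?mulr0 ?normr0 ?mul0r //; lia.
have box_lt x : (m * (x %% n) %/ n < m)%N.
  by rewrite ltn_divLR // ltn_pmul2l // ltn_pmod.
pose box (t : 'I_n) := (Ordinal (box_lt (k * t)%N), Ordinal (box_lt (l * t)%N)).
have /injectivePn[t1 [t2 t12 [eqk eql]]] : ~~ injectiveb box.
  apply: contraL m2_ltn => /injectiveP/leq_card.
  by rewrite card_prod !card_ord -leqNgt mulnn.
have close x y : (m * (x %% n) %/ n)%N = (m * (y %% n) %/ n)%N ->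
    `|(x %% n)%:Z - (y %% n)%:Z| * m%:Z < n%:Z.
  rewrite -[m%:Z]ger0_norm // -normrM mulrBl ltr_norml -!PoszM.
  rewrite ![(_ %% n * m)%N]mulnC.
  move: (m * _)%N (m * _)%N => u v E.
  rewrite (divn_eq u n) (divn_eq v n) E.
  have := ltn_pmod u n_gt0; have := ltn_pmod v n_gt0.
  by move: (_ * n)%N (u %% n)%N (v %% n)%N; clear; lia.
exists (t1%:Z - t2%:Z), ((k * t1 %% n)%:Z - (k * t2 %% n)%:Z),
  ((l * t1 %% n)%:Z - (l * t2 %% n)%:Z),
  ((k * t1 %/ n)%:Z - (k * t2 %/ n)%:Z), ((l * t1 %/ n)%:Z - (l * t2 %/ n)%:Z).
have divE x : x%:Z = (x %/ n)%:Z * n%:Z + (x %% n)%:Z.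
  by rewrite {1}(divn_eq x n) PoszD PoszM.
split; [| | | exact: close | exact: close].
- by rewrite mulrBr -!PoszM (divE (k * t1)%N) (divE (k * t2)%N); ring.
- by rewrite mulrBr -!PoszM (divE (l * t1)%N) (divE (l * t2)%N); ring.
(* If both differences vanished, [n] would divide [k * (t1 - t2)] and [l * (t1 - t2)], hence
   [t1 - t2] by the gcd condition, although [t1] and [t2] are below [n]. *)
apply: contraR t12; rewrite negb_or !negbK !subr_eq0 !eqz_nat => /andP[k12 l12].
apply/eqP/val_inj; move: (ltn_ord t1) (ltn_ord t2) k12 l12 => /=.
move: (nat_of_ord t1) (nat_of_ord t2); clear -n_gt0 kln1 => t1 t2.
wlog le21 : t1 t2 / (t2 <= t1)%N => [wlogt|] t1n t2n.
  by case/orP: (leq_total t2 t1) => le12 k12 l12; [|symmetry];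
     apply: wlogt; rewrite // eq_sym.
rewrite !eqn_mod_dvd ?leq_mul2l ?le21 ?orbT // -!mulnBr => k12 l12.
have : (n %| gcdn k l * (t1 - t2))%N by rewrite muln_gcdl dvdn_gcd k12 l12.
rewrite Gauss_dvdr; last by rewrite coprime_sym /coprime kln1.
have [|d_gt0 /(dvdn_leq d_gt0)] := posnP (t1 - t2); lia.
Qed.

(* When [a] divides [b], put the first phase at [0] and move along the subgroup
   with [t]; otherwise keep [t = 0] and move the first phase through the
   multiples of [2 * pi] with [u]. *)
Lemma line_through_maximum (R : realType) (n : nat) (k l a b : int)
    (alpha beta : R) :
  (0 < n)%N -> a != 0 -> `|b| <= `|a| ->
  ~~ (n%:Z %| l)%Z -> ~~ (n%:Z %| l - k)%Z -> ~~ (n%:Z %| l + k)%Z ->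
  exists (t : int) (u : R),
    cos (alpha + 2 * pi * (k%:~R * t%:~R / n%:R) + a%:~R * u) = 1 /\
    0 <= cos (beta + 2 * pi * (l%:~R * t%:~R / n%:R) + b%:~R * u).
Proof.
move=> n_gt0 a_neq0 le_ba nl nlBk nlDk.
have n_neq0 : n%:R != 0 :> R by rewrite pnatr_eq0 -lt0n.
have nz_neq0 : n%:Z != 0 by rewrite eqz_nat -lt0n.
have aR_neq0 : a%:~R != 0 :> R by rewrite intr_eq0.
have [/dvdzP[c bE]|a_ndvd_b] := boolP (a %| b)%Z.
  (* The bound on [b] leaves [c] equal to 0, 1 or -1: one case for each non-divisibility
     hypothesis. *)
  have nlBck : ~~ (n%:Z %| l - c * k)%Z.
    have c_le1 : `|c| <= 1.
      by move: le_ba; rewrite bE normrM -{2}[`|a|]mul1r ler_pM2r ?normr_gt0.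
    have [->|[->|->]] : c = 0 \/ c = 1 \/ c = -1.
      by move: c_le1; clear; lia.
    - by rewrite mul0r subr0.
    - by rewrite mul1r.
    - by rewrite mulN1r opprK.
  have [t cos_ge0] := cos_progression_ge0 (beta - c%:~R * alpha) nz_neq0 nlBck.
  exists t, (- (alpha + 2 * pi * (k%:~R * t%:~R / n%:R)) / a%:~R); split.
    by rewrite [X in cos X](_ : _ = 0) ?cos0 //; field; rewrite aR_neq0.
  move: cos_ge0; congr (0 <= cos _).
  rewrite bE rmorphM rmorphB rmorphM /=; field.
  by rewrite aR_neq0 n_neq0.
have [j cos_ge0] :=
  cos_progression_ge0 (beta - b%:~R / a%:~R * alpha) a_neq0 a_ndvd_b.
exists 0, ((2 * pi * j%:~R - alpha) / a%:~R).
rewrite !mulr0 !mul0r !mulr0 !addr0; split.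
  rewrite [X in cos X](_ : _ = 0 + 2 * pi * j%:~R) ?cosD2piz ?cos0 //; field.
  exact: aR_neq0.
move: cos_ge0; congr (0 <= cos _); field.
by rewrite aR_neq0.
Qed.

(** Adding [j * t0] to [t] moves the phases by [2 * pi * j / n] times [a] and [b], up to whole
    turns. Rounding the real parameter [u] to such a point costs at most [pi / m] in each cosine. *)
Lemma two_cosines_near_max (R : realType) (n m : nat) (k l t0 a b p q : int)
    (alpha beta r1 r2 eps : R) :
  (0 < n)%N -> (0 < m)%N -> 0 <= r1 -> 0 <= r2 -> (r1 + r2) * pi < eps * m%:R ->
  k * t0 = a + n%:Z * p -> l * t0 = b + n%:Z * q ->
  a != 0 -> `|b| <= `|a| -> `|a| * m%:Z < n%:Z ->
  ~~ (n%:Z %| l)%Z -> ~~ (n%:Z %| l - k)%Z -> ~~ (n%:Z %| l + k)%Z ->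
  exists t : int,
    r1 - eps < r1 * cos (alpha + 2 * pi * (k%:~R * t%:~R / n%:R)) +
               r2 * cos (beta + 2 * pi * (l%:~R * t%:~R / n%:R)).
Proof.
move=> n_gt0 m_gt0 r1_ge0 r2_ge0 rpi_lt kE lE a_neq0 le_ba am_ltn nl nlBk nlDk.
have nR_gt0 : 0 < n%:R :> R by rewrite ltr0n.
have mR_gt0 : 0 < m%:R :> R by rewrite ltr0n.
have pi_gt0R : 0 < pi :> R := pi_gt0 R.
have [t [u [cos1 cos_ge0]]] :=
  line_through_maximum alpha beta n_gt0 a_neq0 le_ba nl nlBk nlDk.
(* Adding one half before the floor rounds to the nearest integer, so [w] is at most half the
   spacing [2 * pi / n]. *)
pose j := Num.floor (u * n%:R / (2 * pi) + 2^-1).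
pose w := u - 2 * pi * (j%:~R / n%:R).
have w_le : `|w| <= pi / n%:R.
  have /andP[j_le j_gt] := floor_itv (u * n%:R / (2 * pi) + 2^-1).
  have -> : w = (u * n%:R / (2 * pi) - j%:~R) * (2 * (pi / n%:R)).
    rewrite /w; move: (pi : R) pi_gt0R => c c_gt0.
    by field; rewrite !lt0r_neq0.
  have gap_gt0 : 0 < 2 * (pi / n%:R) :> R by rewrite mulr_gt0 // divr_gt0.
  rewrite normrM (gtr0_norm gap_gt0).
  rewrite (mulrA `|_|); apply: ler_piMl; first by rewrite divr_ge0 ?ltW.
  rewrite -ler_pdivlMr // ler_norml.
  by move: j_le j_gt; rewrite -/j rmorphD /=; lra.
exists (t + j * t0).
(* Used for both phases, with [(i, c, e)] equal to [(k, a, p)] and to [(l, b, q)]. *)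
have approx (x : R) (i c e : int) : i * t0 = c + n%:Z * e -> `|c| <= `|a| ->
    cos (x + 2 * pi * (i%:~R * t%:~R / n%:R) + c%:~R * u) - pi / m%:R <=
    cos (x + 2 * pi * (i%:~R * (t + j * t0)%:~R / n%:R)).
  move=> iE le_ca.
  set X := x + _ + c%:~R * u.
  have -> : x + 2 * pi * (i%:~R * (t + j * t0)%:~R / n%:R) =
            X - c%:~R * w + 2 * pi * (e * j)%:~R.
    rewrite /X /w; have -> : c%:~R = i%:~R * t0%:~R - n%:R * e%:~R :> R.
      by rewrite -rmorphM iE rmorphD rmorphM addrK.
    by rewrite !(rmorphD, rmorphM) /=; field; rewrite lt0r_neq0.
  rewrite cosD2piz; have := cos_lipschitz X (X - c%:~R * w).
  rewrite subKr => /(le_trans (ler_norm _)).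
  suff : `|c%:~R * w| <= pi / m%:R by lra.
  rewrite normrM ler_pdivlMr //.
  apply: (@le_trans _ _ (`|a|%:~R * (pi / n%:R) * m%:R)).
    apply: ler_wpM2r; [exact: ltW | apply: ler_pM => //].
    by rewrite -intr_norm ler_int.
  have am_lenR : `|a|%:~R * m%:R <= n%:R :> R.
    by rewrite -[m%:R]/(m%:Z%:~R) -rmorphM -[n%:R]/(n%:Z%:~R) ler_int ltW.
  rewrite mulrA mulrAC ler_pdivrMr // mulrAC mulrC.
  by apply: ler_wpM2l; first exact: ltW.
have := approx alpha k a p kE (lexx _); rewrite cos1.
have := approx beta l b q lE le_ba.
set C1 := cos _; set C2 := cos _; set C3 := cos _ => C12 C3_ge.
have {C12} C2_ge : - (pi / m%:R) <= C2 by move: cos_ge0 C12; rewrite -/C1; lra.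
have := ler_wpM2l r1_ge0 C3_ge; have := ler_wpM2l r2_ge0 C2_ge.
suff : (r1 + r2) * (pi / m%:R) < eps by lra.
by rewrite mulrA ltr_pdivrMr.
Qed.

(** The strict bound serves the pigeonhole; the other one turns the lower bound on [n] into one on
    [m]. *)
Lemma between_squares (n : nat) :
  (0 < n)%N -> exists2 m, (m ^ 2 < n)%N & (n <= m.+1 ^ 2)%N.
Proof.
move=> n_gt0.
have ex_m : exists m, (n <= m.+1 ^ 2)%N by exists n; rewrite -mulnn; nia.
case: (ex_minnP ex_m) => [[|m] n_le m_min]; first by exists 0%N.
by exists m.+1 => //; rewrite ltnNge; apply/negP => /m_min; rewrite ltnn.
Qed.

(** The interval accommodates [l], [l - k] and [l + k] alike, and its only multiples of [n] are 0
    and [n]. *)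
Lemma ndvdz_between (n z : int) :
  - n < z -> z < n * 2 -> z != 0 -> z != n -> ~~ (n %| z)%Z.
Proof.
move=> z_gt z_lt z_neq0 z_neqn; apply/negP => /dvdzP[c zE].
have [c0|c1] : c = 0 \/ c = 1 by nia.
  by move: z_neq0; rewrite zE c0 mul0r.
by move: z_neqn; rewrite zE c1 mul1r eqxx.
Qed.

Lemma ndvdz_indices (n k l : nat) :
  (1 <= k <= n - 1)%N -> (1 <= l <= n - 1)%N -> k <> l -> k <> (n - l)%N ->
  [/\ ~~ (n%:Z %| l%:Z)%Z, ~~ (n%:Z %| l%:Z - k%:Z)%Z &
      ~~ (n%:Z %| l%:Z + k%:Z)%Z].
Proof.
by move=> k_itv l_itv k_neq_l k_neq_nl; split; apply: ndvdz_between; lia.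
Qed.

Theorem theorem6p9 (R : realType) (lambda1 mu1 lambda2 mu2 eps : R)
  (eps_gt0 : 0 < eps) (theta1 theta2 : R) :
  let A : int :=
    Num.max 17
      (Num.ceil (2 * pi *
         ((`|lambda1| + `|lambda2| + `|mu1| + `|mu2|) / eps)) ^+ 2) in
  let s : R :=
    Num.min (lambda1 ^+ 2 + mu1 ^+ 2 + 2 * lambda1 * mu1 * cos theta1)
            (lambda2 ^+ 2 + mu2 ^+ 2 + 2 * lambda2 * mu2 * cos theta2) in
  forall n k l : nat,
    A <= n%:Z ->
    (1 <= k <= n - 1)%N -> (1 <= l <= n - 1)%N ->
    k <> l -> k <> (n - l)%N -> gcdn (gcdn k l) n = 1%N ->
  exists t : int,
    lambda1 * cos (k%:R * (theta1 + 2 * pi * t%:~R) / n%:R)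
    + mu1 * cos ((n%:R - k%:R) * (theta1 + 2 * pi * t%:~R) / n%:R)
    + lambda2 * cos (l%:R * (theta2 + 2 * pi * t%:~R) / n%:R)
    + mu2 * cos ((n%:R - l%:R) * (theta2 + 2 * pi * t%:~R) / n%:R)
    > Num.sqrt s - eps.
Proof.
move=> A s n k l; rewrite /A ge_max => /andP[n_ge17 ceil_len] k_itv l_itv.
move=> k_neq_l k_neq_nl kln1.
have n_gt0 : (0 < n)%N by move: n_ge17; clear; lia.
have nR_neq0 : n%:R != 0 :> R by rewrite pnatr_eq0 -lt0n.
have [m m2_ltn n_le] := between_squares n_gt0.
have m_ge4 : (4 <= m)%N.
  rewrite leqNgt; apply/negP => m_lt4.
  have n_le16 : (n <= 4 ^ 2)%N by rewrite (leq_trans n_le) // leq_exp2r.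
  by move: n_ge17 n_le16; clear; lia.
have m_gt0 : (0 < m)%N by rewrite (leq_trans _ m_ge4).
have [r1 r1E [r1_le [phi1 phi1E]]] :=
  cos_combination_amplitude lambda1 mu1 theta1.
have [r2 r2E [r2_le [phi2 phi2E]]] :=
  cos_combination_amplitude lambda2 mu2 theta2.
have r1_ge0 : 0 <= r1 by rewrite r1E sqrtr_ge0.
have r2_ge0 : 0 <= r2 by rewrite r2E sqrtr_ge0.
have s_le1 : Num.sqrt s <= r1 by rewrite r1E ler_wsqrtr // ge_min lexx.
have s_le2 : Num.sqrt s <= r2 by rewrite r2E ler_wsqrtr // ge_min lexx orbT.
(* From [x <= m + 1] one gets [L * pi <= eps * (m + 1) / 2], which is below [eps * m] since
   [m > 1]. *)
have rpi_lt : (r1 + r2) * pi < eps * m%:R.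
  move: ceil_len; set L := (_ + _ + _ + _); set x := 2 * pi * _ => ceil_len.
  have r_le : r1 + r2 <= L by rewrite /L; lra.
  have ceil_le : Num.ceil x <= m.+1%:Z.
    rewrite leNgt; apply/negP; move: (Num.ceil x) ceil_len n_le => c.
    by rewrite -mulnn expr2; clear; nia.
  have : x <= m.+1%:R.
    by rewrite (le_trans (ceil_ge x)) // -[m.+1%:R]/(m.+1%:Z%:~R) ler_int.
  rewrite /x mulrA ler_pdivrMr // -natr1 => Lpi_le.
  have := ler_wpM2r (pi_ge0 R) r_le.
  have : eps < eps * m%:R by rewrite ltr_pMr // ltr1n (leq_trans _ m_ge4).
  by move: Lpi_le; lra.
have [nl nlBk nlDk] := ndvdz_indices k_itv l_itv k_neq_l k_neq_nl.
have l_neq_nk : l <> (n - k)%N.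
  by move: k_neq_nl k_itv l_itv; clear; lia.
have [nk nkBl nkDl] := ndvdz_indices l_itv k_itv (nesym k_neq_l) l_neq_nk.
suff [t t_gt] : exists t : int, Num.sqrt s - eps <
    r1 * cos (k%:R * theta1 / n%:R - phi1 + 2 * pi * (k%:R * t%:~R / n%:R)) +
    r2 * cos (l%:R * theta2 / n%:R - phi2 + 2 * pi * (l%:R * t%:~R / n%:R)).
  exists t; apply: (lt_le_trans t_gt); rewrite le_eqVlt; apply/orP; left.
  have pairE (i : nat) (la mu theta phi r : R) :
      (forall x, la * cos x + mu * cos (theta - x) = r * cos (x - phi)) ->
      la * cos (i%:R * (theta + 2 * pi * t%:~R) / n%:R) +
      mu * cos ((n%:R - i%:R) * (theta + 2 * pi * t%:~R) / n%:R) =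
      r * cos (i%:R * theta / n%:R - phi + 2 * pi * (i%:R * t%:~R / n%:R)).
    move=> phiE; set x := i%:R * (_ + _) / _.
    have -> : (n%:R - i%:R) * (theta + 2 * pi * t%:~R) / n%:R =
              theta - x + 2 * pi * t%:~R by rewrite /x; field.
    by rewrite cosD2piz phiE; congr (_ * cos _); rewrite /x; field.
  rewrite -(addrA (_ + _)).
  by rewrite !(pairE _ _ _ _ _ _ phi1E, pairE _ _ _ _ _ _ phi2E).
have [t0 [a [b [p [q [kE lE ab_neq0 am_lt bm_lt]]]]]] :=
  short_lattice_vector n_gt0 m2_ltn kln1.
(* The cosine brought to 1 is the one with the longer coordinate; either choice works, as both
   amplitudes are at least [Num.sqrt s]. *)
have [le_ba|lt_ab] := leP `|b| `|a|.
  have a_neq0 : a != 0 by move: ab_neq0 le_ba; clear; lia.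
  have [t t_gt] := two_cosines_near_max (k%:R * theta1 / n%:R - phi1)
    (l%:R * theta2 / n%:R - phi2) n_gt0 m_gt0 r1_ge0 r2_ge0 rpi_lt kE lE
    a_neq0 le_ba am_lt nl nlBk nlDk.
  by exists t; apply: le_lt_trans t_gt; rewrite lerD2r.
have b_neq0 : b != 0 by move: lt_ab; clear; lia.
rewrite addrC in rpi_lt.
have [t t_gt] := two_cosines_near_max (l%:R * theta2 / n%:R - phi2)
  (k%:R * theta1 / n%:R - phi1) n_gt0 m_gt0 r2_ge0 r1_ge0 rpi_lt lE kE
  b_neq0 (ltW lt_ab) bm_lt nk nkBl nkDl.
by exists t; rewrite [ltRHS]addrC; apply: le_lt_trans t_gt; rewrite lerD2r.
Qed.
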